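(* Let $T,U\in\mathcal{GB}(H)$ and let $\Lambda_T=\{(W_j,\Lambda_j,v_j)\}_{j\in J}$ be a $(T,T)$-controlled $g$-fusion Bessel sequence in $H$ with bound $B$. If $\{v_j^2T^*P_{W_j}\Lambda_j^*\Lambda_jP_{W_j}U\}_{j\in J}$ is a resolution of the identity operator on $H$, then $\Lambda_T$ is a $(U,U)$-controlled $g$-fusion frame for $H$.
   Context: $H$ is a separable Hilbert space, $J\subset\mathbb{Z}$, $\{H_j\}_{j\in J}$ is a collection of Hilbert spaces, $\{W_j\}_{j\in J}$ are closed subspaces of $H$, $\{v_j\}_{j\in J}$ are positive weights, and $\Lambda_j\in\mathcal{B}(H,H_j)$ (bounded linear operators). $\mathcal{GB}(H)$ is the set of bounded linear operators on $H$ having a bounded inverse. $P_M$ is the orthogonal projection onto a closed subspace $M$. For $R\in\mathcal{GB}(H)$, the family $\{(W_j,\Lambda_j,v_j)\}_{j\in J}$ is an $(R,R)$-controlled $g$-fusion frame for $H$ if there are $0<a\le b<\infty$ with $$a\|f\|^2\le\sum_{j\in J}v_j^2\langle\Lambda_jP_{W_j}Rf,\Lambda_jP_{W_j}Rf\rangle\le b\|f\|^2\quad\text{for all } f\in H;$$ it is an $(R,R)$-controlled $g$-fusion Bessel sequence with bound $b$ if the right-hand inequality holds. A family of bounded operators $\{R_j\}_{j\in J}$ on $H$ is a resolution of the identity operator on $H$ if $f=\sum_{j\in J}R_j(f)$ for all $f\in H$, with the series converging unconditionally for every $f\in H$. *)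

(* Defs.v *)
From HB Require Import structures.
From mathcomp Require Import all_boot all_order all_algebra.
From mathcomp Require Import sesquilinear finmap complex.
From mathcomp Require Import all_classical all_reals all_analysis.
From mathcomp.analysis.showcase Require Import summability.

Set Implicit Arguments.
Unset Strict Implicit.
Unset Printing Implicit Defensive.

Import Order.TTheory GRing.Theory Num.Theory.
Import numFieldNormedType.Exports.

Local Open Scope classical_set_scope.
Local Open Scope ring_scope.

(* Hilbert spaces are taken over either the real or the complex numbers. *)
Variant scalar_kind := RealScalars | ComplexScalars.

Definition scalar_field (R : realType) (s : scalar_kind) : numFieldType :=
  match s with
  | RealScalars => R
  | ComplexScalars => R[i]
  end.

Definition scalar_conj (R : realType) (s : scalar_kind) :
    scalar_field R s -> scalar_field R s :=
  match s with
  | RealScalars => fun x : R => x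
  | ComplexScalars => fun z : R[i] => conjc z
  end.

Definition scalar_re (R : realType) (s : scalar_kind) : scalar_field R s -> R :=
  match s with
  | RealScalars => fun x : R => x
  | ComplexScalars => fun z : R[i] => complex.Re z
  end.

Definition of_real (R : realType) (s : scalar_kind) : R -> scalar_field R s :=
  match s with
  | RealScalars => fun x : R => x
  | ComplexScalars => fun x : R => (x%:C)%C
  end.
Arguments of_real {R} s.

(* [{dot H for conj}] is linear in its first argument, conjugate-linear in the
   second one. *)
HB.mixin Record isHilbert (R : realType) (s : scalar_kind) H
    of CompleteNormedModule (scalar_field R s) H := {
  dot : {dot H for @scalar_conj R s};
  sqr_normE : forall x : H, `|x| ^+ 2 = dot x x
}.

#[short(type="hilbertType")]
HB.structure Definition Hilbert (R : realType) (s : scalar_kind) :=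
  {H of isHilbert R s H & CompleteNormedModule (scalar_field R s) H}.

Section Operators.
Context {R : realType} {s : scalar_kind}.

(* The norm of a normed module over [R[i]] has values in [R[i]]. *)
Definition hnorm (H : hilbertType R s) (x : H) : R := scalar_re `|x|.

Definition separable_space (H : hilbertType R s) : Prop :=
  exists D : set H, countable D /\ dense D.

Definition closed_subspace (H : hilbertType R s) (W : set H) : Prop :=
  [/\ W 0,
      forall (a : scalar_field R s) (x y : H), W x -> W y -> W (a *: x + y)
    & closed W].

Definition bounded_operator (H1 H2 : hilbertType R s) (F : H1 -> H2) : Prop :=
  linear F /\ exists M : R, forall x : H1, hnorm (F x) <= M * hnorm x.

Definition GB (H : hilbertType R s) (F : H -> H) : Prop :=
  bounded_operator F /\
  exists G : H -> H, [/\ bounded_operator G, cancel F G & cancel G F].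

(* Total functions defined by choice from the characteristic property; the
   default value [0] is never used when [W] is a closed subspace. *)
Definition orth_proj (H : hilbertType R s) (W : set H) (x : H) : H :=
  xget 0 [set y | W y /\ forall w : H, W w -> dot (x - y) w = 0].

(* The default value [0] is never used when [F] is a bounded operator. *)
Definition adjoint (H1 H2 : hilbertType R s) (F : H1 -> H2) (y : H2) : H1 :=
  xget 0 [set z | forall x : H1, dot (F x) y = dot x z].

(* The family is indexed by an unordered set: unconditional convergence is
   convergence of the net of the sums over the finite subsets of [J]. *)
Definition resolution_of_identity (H : hilbertType R s) (J : set int)
    (F : J -> H -> H) : Prop :=
  (forall j : J, bounded_operator (F j)) /\
  forall f : H, partial_sum (fun j : J => F j f) @ totally --> f.

Section Families.
Variables (H : hilbertType R s) (J : set int) (Hj : J -> hilbertType R s).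
Variables (W : J -> set H) (L : forall j : J, H -> Hj j) (v : J -> R).

(* An unordered sum of nonnegative terms, possibly [+oo]. *)
Definition controlled_sum (C : H -> H) (f : H) : \bar R :=
  \esum_(j in [set: J])
    (v j ^+ 2 * scalar_re (dot (L j (orth_proj (W j) (C f)))
                               (L j (orth_proj (W j) (C f)))))%:E.

Definition controlled_bessel (C : H -> H) (b : R) : Prop :=
  forall f : H, (controlled_sum C f <= (b * hnorm f ^+ 2)%:E)%E.

Definition controlled_frame (C : H -> H) : Prop :=
  exists a b : R, [/\ 0 < a, a <= b &
    forall f : H, ((a * hnorm f ^+ 2)%:E <= controlled_sum C f)%E /\
                  (controlled_sum C f <= (b * hnorm f ^+ 2)%:E)%E].

End Families.
End Operators.

(* Main.v *)
(** Write [S_C f] for the controlled sum of [f].  Pairing the identity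
    [f = sum_j v_j^2 T* P_j L_j* L_j P_j U f] with [f] gives
    [|f|^2 = sum_j v_j^2 <L_j P_j U f, L_j P_j T f>], so by the inequality of
    arithmetic and geometric means
    [2 B |f|^2 <= B^2 S_U f + S_T f <= B^2 S_U f + B |f|^2], hence the lower
    bound [|f|^2 / B <= S_U f].  The upper bound comes from
    [S_U f = S_T (T^-1 U f)].  Adjoints and projections are given by choice, so
    both must be shown to exist: minimizing the distance to a closed subspace
    gives the projection, and the projection onto the kernel of a functional
    gives the Riesz representation.  Outside the Riesz representation only real
    parts of inner products matter, which treats the real and complex cases
    together. *)

Require Import Defs.
From HB Require Import structures.
From mathcomp Require Import all_boot all_order all_algebra.
From mathcomp Require Import sesquilinear finmap complex.
From mathcomp Require Import all_classical all_reals all_analysis.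
From mathcomp.analysis.showcase Require Import summability.
From mathcomp Require Import ring lra.

Set Implicit Arguments.
Unset Strict Implicit.
Unset Printing Implicit Defensive.

Import Order.TTheory GRing.Theory Num.Theory.
Import numFieldNormedType.Exports.

Local Open Scope classical_set_scope.
Local Open Scope ring_scope.

(** * Real and complex scalars under one interface *)

Section Scalars.
Context {R : realType} {s : scalar_kind}.
Local Notation K := (scalar_field R s).
Implicit Types (x y : R) (z w : K).

Lemma scalar_reD z w : scalar_re (z + w) = scalar_re z + scalar_re w.
Proof. by case: s z w => [|] //= [a b] [c d]. Qed.

Lemma scalar_reN z : scalar_re (- z) = - scalar_re z.
Proof. by case: s z => [|] //= [a b]. Qed.

Lemma scalar_re_conj z : scalar_re (scalar_conj z) = scalar_re z.
Proof. by case: s z => [|] //= [a b]. Qed.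

Lemma scalar_re_of_realM x z : scalar_re (of_real s x * z) = x * scalar_re z.
Proof. by case: s z => [|] //= [a b] /=; rewrite mul0r subr0. Qed.

Lemma of_realK x : scalar_re (of_real s x) = x.
Proof. by case: s. Qed.

Lemma of_real0 : of_real s 0 = 0 :> K.
Proof. by case: s. Qed.

Lemma of_real1 : of_real s 1 = 1 :> K.
Proof. by case: s. Qed.

Lemma of_realM x y : of_real s (x * y) = of_real s x * of_real s y.
Proof. by case: s => //=; rewrite rmorphM. Qed.

Lemma of_real_nat n : of_real s n%:R = n%:R :> K.
Proof. by case: s => //=; rewrite rmorph_nat. Qed.

Lemma scalar_conj_of_real x : scalar_conj (of_real s x) = of_real s x.
Proof. by case: s => //=; rewrite oppr0. Qed.

Lemma of_real_ltr x y : (of_real s x < of_real s y) = (x < y).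
Proof. by case: s => //=; rewrite ltcR. Qed.

(** In [R[i]] comparable numbers have equal imaginary parts, so a positive scalar is real. *)
Lemma gt0_of_real z : 0 < z -> z = of_real s (scalar_re z) /\ 0 < scalar_re z.
Proof.
case: s z => [|] //= [a b]; rewrite ltcE /= => /andP[/eqP -> a0].
by split.
Qed.

Lemma normr_of_real z : `|z| = of_real s (scalar_re `|z|).
Proof. by case: s z => [|] //= [a b]; rewrite normc_def. Qed.

Lemma normr_re_ge0 z : 0 <= scalar_re `|z|.
Proof.
have := normr_ge0 z; rewrite le_eqVlt => /predU1P[<-|/gt0_of_real[_ /ltW//]].
by case: (s).
Qed.

Lemma normr_conj z : `|scalar_conj z| = `|z|.
Proof. by case: s z => [|] //= z; rewrite normcJ. Qed.

Lemma scalar_conjK : involutive (@scalar_conj R s).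
Proof. by case: s => [|] //= [a b] /=; rewrite opprK. Qed.

Lemma scalar_conjM z w :
  scalar_conj (z * w) = scalar_conj z * scalar_conj w.
Proof. by case: s z w => [|] z w //=; rewrite rmorphM. Qed.

Lemma scalar_conj_mul z :
  scalar_conj z * z = of_real s (scalar_re `|z| ^+ 2).
Proof.
case: s z => [z|[a b]] /=; first by rewrite real_normK ?num_real.
rewrite sqr_sqrtr ?addr_ge0 ?sqr_ge0//.
by apply/eqP; rewrite eq_complex /=; apply/andP; split; apply/eqP; ring.
Qed.

End Scalars.

(** * Inner products, their real parts and the norm *)

Section InnerProduct.
Context {R : realType} {s : scalar_kind} {H : hilbertType R s}.
Implicit Types x y z : H.

Definition rdot x y : R := scalar_re (dot x y).

Lemma dotC x y : dot x y = scalar_conj (dot y x).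
Proof. by rewrite [LHS]hermitian_subproof expr0 mul1r. Qed.

Lemma dotDl x y z : dot (x + y) z = dot x z + dot y z.
Proof. exact: linearDl. Qed.

Lemma dotZl (a : scalar_field R s) x y : dot (a *: x) y = a * dot x y.
Proof. exact: linearZl_LR. Qed.

Lemma dotNl x y : dot (- x) y = - dot x y.
Proof. exact: linearNl. Qed.

Lemma dotZr (a : scalar_field R s) x y :
  dot x (a *: y) = scalar_conj a * dot x y.
Proof. by rewrite dotC dotZl scalar_conjM -dotC. Qed.

Lemma rdotC x y : rdot x y = rdot y x.
Proof. by rewrite /rdot dotC scalar_re_conj. Qed.

Lemma rdotDl x y z : rdot (x + y) z = rdot x z + rdot y z.
Proof. by rewrite /rdot dotDl scalar_reD. Qed.

Lemma rdotNl x y : rdot (- x) y = - rdot x y.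
Proof. by rewrite /rdot dotNl scalar_reN. Qed.

Lemma rdotZl (a : R) x y : rdot (of_real s a *: x) y = a * rdot x y.
Proof. by rewrite /rdot dotZl scalar_re_of_realM. Qed.

Lemma rdotDr x y z : rdot x (y + z) = rdot x y + rdot x z.
Proof. by rewrite rdotC rdotDl !(rdotC _ x). Qed.

Lemma rdotNr x y : rdot x (- y) = - rdot x y.
Proof. by rewrite rdotC rdotNl rdotC. Qed.

Lemma rdotZr (a : R) x y : rdot x (of_real s a *: y) = a * rdot x y.
Proof. by rewrite rdotC rdotZl rdotC. Qed.

Lemma normr_hnorm x : `|x| = of_real s (hnorm x).
Proof. by rewrite /hnorm -[LHS]normr_id normr_of_real normr_id. Qed.

Lemma hnorm_ge0 x : 0 <= hnorm x.
Proof. by rewrite /hnorm -normr_id normr_re_ge0. Qed.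

Lemma hnormZ (a : scalar_field R s) x :
  hnorm (a *: x) = scalar_re `|a| * hnorm x.
Proof.
by rewrite {1}/hnorm normrZ normr_of_real scalar_re_of_realM of_realK.
Qed.

Lemma hnorm_sqr x : hnorm x ^+ 2 = rdot x x.
Proof.
by rewrite /rdot -sqr_normE normr_hnorm expr2 scalar_re_of_realM of_realK.
Qed.

Lemma hnorm_eq0 x : hnorm x = 0 -> x = 0.
Proof.
move=> x0; apply/normr0_eq0; rewrite normr_hnorm x0.
by case: (s).
Qed.

Lemma rdot_ge0 x : 0 <= rdot x x.
Proof. by rewrite -hnorm_sqr sqr_ge0. Qed.

Lemma hnorm_gt0 x : x != 0 -> 0 < hnorm x.
Proof.
by rewrite lt_def hnorm_ge0 andbT; apply: contraNneq => /hnorm_eq0 ->.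
Qed.

Lemma rdot0l y : rdot 0 y = 0.
Proof. by rewrite -[0 in LHS](subrr 0) rdotDl rdotNl subrr. Qed.

Lemma rdot_cauchy_schwarz x y : rdot x y <= hnorm x * hnorm y.
Proof.
have [->|/hnorm_gt0 x0] := eqVneq x 0.
  by rewrite rdot0l mulr_ge0 ?hnorm_ge0.
have [->|/hnorm_gt0 y0] := eqVneq y 0.
  by rewrite rdotC rdot0l mulr_ge0 ?hnorm_ge0.
(* This vector has squared norm [2 |x| |y| (|x| |y| - rdot x y)]. *)
have := rdot_ge0 (of_real s (hnorm y) *: x - of_real s (hnorm x) *: y).
rewrite rdotDl !rdotDr !rdotNl !rdotNr !rdotZl !rdotZr -!hnorm_sqr (rdotC y x).
have xy0 := mulr_gt0 x0 y0.
rewrite (_ : _ + _ = 2 * (hnorm x * hnorm y) * (hnorm x * hnorm y - rdot x y));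
  last by ring.
by rewrite pmulr_rge0 ?subr_ge0// mulr_gt0.
Qed.

(** Scaling [x] by the conjugate of [dot x y] turns the real part into [|dot x y|^2]. *)
Lemma dot_eq0 x y :
  (forall a : scalar_field R s, rdot (a *: x) y = 0) -> dot x y = 0.
Proof.
move=> /(_ (scalar_conj (dot x y))); rewrite /rdot dotZl scalar_conj_mul.
rewrite of_realK => /eqP; rewrite sqrf_eq0 => /eqP dxy0; apply/normr0_eq0.
by rewrite normr_of_real dxy0; case: (s).
Qed.

Lemma nbhs_hnormP x (A : set H) :
  nbhs x A <-> exists2 e : R, 0 < e & forall y, hnorm (x - y) < e -> A y.
Proof.
split=> [/nbhs_ballP[e /= e0 xeA]|[e e0 xeA]].
- have [ee e0'] := gt0_of_real e0.
  exists (scalar_re e) => // y xy; apply: xeA.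
  by rewrite -ball_normE /= ee normr_hnorm of_real_ltr.
- apply/nbhs_ballP; exists (of_real s e).
    by rewrite /= -(@of_real0 R s) of_real_ltr.
  move=> y; rewrite -ball_normE /= normr_hnorm of_real_ltr; exact: xeA.
Qed.

Lemma closed_hnormP (W : set H) : closed W <->
  forall x, (forall e : R, 0 < e -> exists2 w, W w & hnorm (x - w) < e) -> W x.
Proof.
split=> [cW x xW|cW x clWx].
- apply: cW => A /nbhs_hnormP[e e0 xeA].
  by have [w Ww /xeA Aw] := xW e e0; exists w.
- apply: cW => e e0.
  have [|w [Ww xw]] := clWx [set w | hnorm (x - w) < e]; last by exists w.
  by apply/nbhs_hnormP; exists e.
Qed.

Lemma parallelogram x y :
  rdot (x + y) (x + y) + rdot (x - y) (x - y) = 2 * rdot x x + 2 * rdot y y.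
Proof.
rewrite !(rdotDl, rdotDr, rdotNl, rdotNr) (rdotC y x); ring.
Qed.

Lemma rdot_subZ (t : R) x y :
  rdot (x - of_real s t *: y) (x - of_real s t *: y) =
  rdot x x - 2 * t * rdot x y + t ^+ 2 * rdot y y.
Proof.
rewrite !(rdotDl, rdotDr, rdotNl, rdotNr, rdotZl, rdotZr) (rdotC y x); ring.
Qed.

Lemma hnorm_lt x (e : R) : 0 <= e -> (hnorm x < e) = (rdot x x < e ^+ 2).
Proof. by move=> e0; rewrite -hnorm_sqr ltr_pXn2r ?nnegrE ?hnorm_ge0. Qed.

(** * Orthogonal projection onto a closed subspace *)

Section Projection.
Variables (W : set H) (x : H).
Hypothesis subW : closed_subspace W.

Let dist2 := inf [set rdot (x - w) (x - w) | w in W].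

Let W0 : W 0. Proof. by case: subW. Qed.

Let WZ (a : scalar_field R s) w : W w -> W (a *: w).
Proof. by case: subW => _ Wl _ Ww; rewrite -[_ *: _]addr0; exact: Wl. Qed.

Let WD w w' : W w -> W w' -> W (w + w').
Proof. by case: subW => _ Wl _ Ww Ww'; rewrite -[w]scale1r; exact: Wl. Qed.

Let has_inf_dist2 : has_inf [set rdot (x - w) (x - w) | w in W].
Proof.
split; first by exists (rdot (x - 0) (x - 0)), 0.
by exists 0 => _ [w _ <-]; exact: rdot_ge0.
Qed.

Let dist2_le w : W w -> dist2 <= rdot (x - w) (x - w).
Proof. by move=> Ww; apply: (ge_inf has_inf_dist2.2); exists w. Qed.

Let near_opt (e : R) := [set w | W w /\ rdot (x - w) (x - w) < dist2 + e].

Let near_opt_neq0 (e : R) : 0 < e -> near_opt e !=set0.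
Proof.
move=> e0; have [_ [w Ww <-] wlt] := inf_adherent e0 has_inf_dist2.
by exists w.
Qed.

Let near_optS (e e' : R) : e <= e' -> near_opt e `<=` near_opt e'.
Proof.
move=> ee' w [Ww xw]; split=> //; apply: (lt_le_trans xw).
by rewrite lerD2l.
Qed.

(** The sets of near-minimizers play the role of a minimizing sequence. *)
Let opt_filter := filter_from [set e : R | 0 < e] near_opt.

#[local] Instance opt_proper : ProperFilter opt_filter.
Proof.
apply: filter_from_proper; last exact: near_opt_neq0.
apply: filter_from_filter; first by exists 1 => /=.
move=> e e' /= e0 e0'; exists (Num.min e e'); first by rewrite /= lt_min e0.
by move=> w wm; split; apply: near_optS wm; rewrite ge_min lexx ?orbT.
Qed.

(** Parallelogram law for [x - w] and [x - w']: the midpoint of [w] and [w'] lies in [W], so the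
    squared norm of the sum is at least [4 dist2], while the right side is below [4 (dist2 + e)]. *)
Let near_opt_close (e : R) w w' :
  near_opt e w -> near_opt e w' -> rdot (w - w') (w - w') < 4 * e.
Proof.
move=> [Ww xw] [Ww' xw'].
have := parallelogram (x - w) (x - w').
have -> : x - w + (x - w') = of_real s 2 *: (x - of_real s 2^-1 *: (w + w')).
  rewrite scalerBr scalerA -of_realM divff// of_real1 scale1r.
  by rewrite of_real_nat scaler_nat mulr2n opprD addrACA.
have -> : x - w - (x - w') = - (w - w') by rewrite !opprB addrC addrA subrK.
rewrite rdotZl rdotZr rdotNl rdotNr opprK.
by have := dist2_le (WZ (of_real s 2^-1) (WD Ww Ww')); lra.
Qed.

Let opt_cvg : exists y, opt_filter --> y.
Proof.
have /cauchy_cvg/cvg_ex[y yP] : cauchy opt_filter; last by exists y.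
apply: cauchy_exP => e /gt0_of_real[eE e0].
have e'0 : 0 < scalar_re e ^+ 2 / 4 by rewrite divr_gt0 ?exprn_gt0.
have [w wP] := near_opt_neq0 e'0; exists w.
exists (scalar_re e ^+ 2 / 4) => // w' w'P.
rewrite -ball_normE /= normr_hnorm eE of_real_ltr hnorm_lt ?(ltW e0)//.
apply: (lt_le_trans (near_opt_close wP w'P)).
by rewrite mulrC divfK.
Qed.

(* Comparing a near-optimal [w] with [w + t u] gives
   [2 t <x - w, u> <= r + t^2 |u|^2]; [r] and [t] are chosen small enough to
   contradict [0 < <x - y, u>]. *)
Let opt_orth y u : opt_filter --> y -> W u -> rdot (x - y) u <= 0.
Proof.
move=> xy Wu; rewrite leNgt; apply/negP => c0.
set c := rdot _ _ in c0; set q := rdot u u; set n := hnorm u.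
have q0 : 0 <= q := rdot_ge0 u.
have n0 : 0 <= n := hnorm_ge0 u.
(* This choice gives [t^2 q = t c - t^2], strictly less than [t c]. *)
pose t := c / (q + 1).
have t0 : 0 < t by rewrite divr_gt0// ltr_wpDl.
have tq : t * q + t = c by rewrite /t; field; lra.
(* The errors [r], from near-optimality, and [2 t r n], from replacing the limit [y] by [w], add up
   to [t c / 2]. *)
pose r := t * c / (2 * (1 + 2 * t * n)).
have tn0 : 0 <= t * n by rewrite mulr_ge0 ?(ltW t0).
have den0 : 0 < 1 + 2 * t * n by lra.
have r0 : 0 < r by apply: divr_gt0; apply: mulr_gt0.
have rE : r * (1 + 2 * t * n) = t * c / 2 by rewrite /r; field; lra.
have [w [Ww xw] yw] : exists2 w, near_opt r w & hnorm (y - w) < r.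
  have [e /= e0 eP] : opt_filter [set w | hnorm (y - w) < r].
    by apply: xy; apply/nbhs_hnormP; exists r.
  have [w wP] : near_opt (Num.min e r) !=set0.
    by apply: near_opt_neq0; rewrite lt_min e0.
  exists w; last by apply/eP/near_optS/wP; rewrite ge_min lexx.
  by apply: near_optS wP; rewrite ge_min lexx orbT.
have := dist2_le (WD Ww (WZ (of_real s t) Wu)).
rewrite opprD addrA rdot_subZ -/q; set z := x - w in xw * => h1.
have h2 : c <= rdot z u + r * n.
  have -> : c = rdot z u + rdot (w - y) u.
    by rewrite -rdotDl addrA subrK.
  rewrite lerD2l (le_trans (rdot_cauchy_schwarz _ _))// ler_wpM2r//.
  by rewrite /hnorm distrC ltW.
have : 2 * t * c <= 2 * t * rdot z u + 2 * t * (r * n).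
  by rewrite -mulrDr; apply: ler_wpM2l h2; rewrite mulr_ge0 ?(ltW t0).
have := mulr_gt0 t0 c0.
have := mulr_gt0 t0 t0.
have : t * (t * q) = t * c - t * t by rewrite -tq; ring.
lra.
Qed.

(** The limit lies in [W] by closedness. Applying [opt_orth] to [a *: w] and its opposite kills the
    real part for every scalar [a], hence the whole inner product. *)
Lemma projection_exists :
  exists y, W y /\ forall w : H, W w -> dot (x - y) w = 0.
Proof.
have [y xy] := opt_cvg; exists y; split=> [|w Ww].
- have [_ _ clW] := subW; apply: (closed_hnormP W).1 => // e e0.
  have [r /= r0 rP] : opt_filter [set w | hnorm (y - w) < e].
    by apply: xy; apply/nbhs_hnormP; exists e.
  by have [w wP] := near_opt_neq0 r0; exists w; [case: wP | exact: rP].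
- suff wxy0 : dot w (x - y) = 0.
    by rewrite dotC wxy0 -(@of_real0 R s) scalar_conj_of_real.
  apply: dot_eq0 => a; have aWw := WZ a Ww.
  rewrite rdotC; apply/eqP; rewrite eq_le opt_orth//=.
  by rewrite -oppr_le0 -rdotNr opt_orth// -scaleN1r; exact: WZ.
Qed.

Lemma orth_projP : W (orth_proj W x) /\
  forall w : H, W w -> dot (x - orth_proj W x) w = 0.
Proof.
have [y yP] := projection_exists.
exact: (@xgetI _ 0 [set y | W y /\ forall w : H, W w -> dot (x - y) w = 0] y).
Qed.

End Projection.

(** Real Cauchy-Schwarz for [x] scaled by the conjugate of [dot x y]; one factor [|dot x y|] then
    cancels. *)
Lemma normr_dot_le x y : scalar_re `|dot x y| <= hnorm x * hnorm y.
Proof.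
have := normr_re_ge0 (dot x y); rewrite le_eqVlt => /predU1P[<-|xy0].
  by rewrite mulr_ge0 ?hnorm_ge0.
have := rdot_cauchy_schwarz (scalar_conj (dot x y) *: x) y.
rewrite /rdot dotZl scalar_conj_mul of_realK hnormZ normr_conj -mulrA expr2.
by rewrite ler_pM2l.
Qed.

(** Both sides equal the pairing of the two projections, the residuals being orthogonal to [W]. *)
Lemma orth_proj_selfadjoint (W : set H) x y : closed_subspace W ->
  rdot (orth_proj W x) y = rdot x (orth_proj W y).
Proof.
move=> subW; have [Wx xW] := orth_projP x subW.
have [Wy yW] := orth_projP y subW.
rewrite -[in LHS](subrK (orth_proj W y) y) -[in RHS](subrK (orth_proj W x) x).
by rewrite rdotDr rdotDl [rdot _ (y - _)]rdotC /rdot xW// yW.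
Qed.

(** * Riesz representation and adjoints *)

Lemma riesz_representation (F : H -> scalar_field R s) : scalar F ->
  (exists M : R, forall x, scalar_re `|F x| <= M * hnorm x) ->
  exists z, forall x, F x = dot x z.
Proof.
move=> linF [M FM].
have FB x y : F (x - y) = F x - F y.
  by rewrite addrC -scaleN1r linF mulN1r addrC.
have F0 : F 0 = 0 by rewrite -(subrr 0) FB subrr.
have FZ a x : F (a *: x) = a * F x by rewrite -[a *: x]addr0 linF F0 addr0.
pose N : set H := [set x | F x = 0].
have subN : closed_subspace N.
  split=> [//|a x y /= Fx Fy|]; first by rewrite /N /= linF Fx Fy mulr0 addr0.
  apply/closed_hnormP => x xN; apply/normr0_eq0; rewrite normr_of_real.
  suff -> : scalar_re `|F x| = 0 by exact: of_real0.
  apply/eqP; rewrite eq_le normr_re_ge0 andbT leNgt; apply/negP => Fx0.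
  (* A kernel point [w] within [|F x| / (|M| + 1)] of [x] would give
     [|F x| = |F (x - w)| < |F x|]. *)
  have M0 : 0 < `|M| + 1 by rewrite ltr_wpDl.
  have [w Fw] := xN _ (divr_gt0 Fx0 M0).
  rewrite ltr_pdivlMr// ltNge => /negP; apply.
  have := FM (x - w); rewrite FB Fw subr0 => /le_trans; apply.
  rewrite mulrC ler_wpM2l ?hnorm_ge0// (le_trans (ler_norm M))//.
  by rewrite lerDl.
have [FT0|/existsNP[x0 Fx0]] := pselect (forall x, F x = 0).
  by exists 0 => x; rewrite FT0 linear0r.
(* [u] is orthogonal to the kernel and [F u] is nonzero, so a multiple of [u] represents [F]. *)
pose u := x0 - orth_proj N x0.
have [Nx0 uN] := orth_projP x0 subN.
have Fu : F u = F x0 by rewrite FB Nx0 subr0.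
have uu0 : dot u u != 0.
  apply: contra_notN Fx0 => /eqP uu0; rewrite -Fu; suff -> : u = 0 by [].
  by apply/normr0_eq0/eqP; rewrite -sqrf_eq0 sqr_normE uu0.
exists (scalar_conj (F u / dot u u) *: u) => x.
rewrite dotZr scalar_conjK.
(* The second vector lies in the kernel; this orthogonality can be solved for [F x]. *)
have : dot u (F u *: x - F x *: u) = 0.
  by apply: uN; rewrite /N /= FB !FZ mulrC subrr.
rewrite dotC dotDl dotNl !dotZl => /(congr1 (@scalar_conj R s)).
rewrite scalar_conjK -(@of_real0 R s) scalar_conj_of_real of_real0.
by move/eqP; rewrite subr_eq0 mulrAC => /eqP ->; rewrite mulfK.
Qed.

End InnerProduct.

(** Riesz applied to [x |-> dot (F x) y] shows that the choice in [adjoint] finds a true adjoint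
    value rather than its default. *)
Lemma adjointP (R : realType) (s : scalar_kind) (H1 H2 : hilbertType R s)
    (F : H1 -> H2) (x : H1) (y : H2) : bounded_operator F ->
  dot (F x) y = dot x (adjoint F y).
Proof.
move=> [linF [M FM]].
have [||] := @riesz_representation _ _ _ (fun x => dot (F x) y).
- by move=> a u v; rewrite linF dotDl dotZl.
- exists (M * hnorm y) => u; rewrite (le_trans (normr_dot_le _ _))//.
  by rewrite mulrAC ler_wpM2r ?hnorm_ge0.
by move=> z zP; exact: (@xgetI _ 0 [set z | forall x, dot (F x) y = dot x z] z).
Qed.

Lemma rdot_adjoint (R : realType) (s : scalar_kind) (H1 H2 : hilbertType R s)
    (F : H1 -> H2) (x : H1) (y : H2) : bounded_operator F ->
  rdot (F x) y = rdot x (adjoint F y).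
Proof. by move=> bF; rewrite /rdot adjointP. Qed.

Lemma bounded_operator_ge0 (R : realType) (s : scalar_kind)
    (H1 H2 : hilbertType R s) (F : H1 -> H2) : bounded_operator F ->
  exists2 M : R, 0 <= M & forall x, hnorm (F x) <= M * hnorm x.
Proof.
move=> [_ [M FM]]; exists `|M| => // x; apply: (le_trans (FM x)).
by rewrite ler_wpM2r ?hnorm_ge0// ler_norm.
Qed.

(** * Unordered sums and the frame bounds *)

Lemma partial_sum_le_esum (R : realType) (I : choiceType) (a : I -> R)
    (A : {fset I}) :
  ((partial_sum a A)%:E <= \esum_(i in [set: I]) (a i)%:E)%E.
Proof.
apply: esum_ge; exists [set` A]; first by split=> //; exact: finite_fset.
rewrite fsbig_finite//= set_fsetK sumEFin lee_fin.
by rewrite [leRHS]big_seq_fsetE.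
Qed.

Lemma rdot_partial_sum (R : realType) (s : scalar_kind) (H : hilbertType R s)
    (I : choiceType) (F : I -> H) (A : {fset I}) (f : H) :
  rdot (partial_sum F A) f = partial_sum (fun i => rdot (F i) f) A.
Proof.
rewrite /partial_sum; elim/big_rec2: _ => [|i x y _ <-]; first exact: rdot0l.
by rewrite rdotDl.
Qed.

Lemma controlled_sum_bound (R : realType) (s : scalar_kind)
    (H : hilbertType R s) (J : set int) (Hj : J -> hilbertType R s)
    (W : J -> set H) (L : forall j : J, H -> Hj j) (v : J -> R)
    (T U : H -> H) (B : R) : 0 <= B -> GB T -> bounded_operator U ->
  controlled_bessel W L v T B ->
  exists2 b, 0 <= b & controlled_bessel W L v U b.
Proof.
move=> B0 [_ [G [bG _ GK]]] bU hB.
have [M M0 GM] := bounded_operator_ge0 bG.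
have [N N0 UN] := bounded_operator_ge0 bU.
(* [M * N] bounds the norm of [G \o U], where [G] is the inverse of [T]. *)
exists (B * (M * N) ^+ 2) => [|f]; first by rewrite mulr_ge0 ?sqr_ge0.
have -> : controlled_sum W L v U f = controlled_sum W L v T (G (U f)).
  by rewrite /controlled_sum GK.
apply: (le_trans (hB _)); rewrite lee_fin -mulrA ler_wpM2l// -exprMn.
rewrite ler_pXn2r ?nnegrE ?mulr_ge0 ?hnorm_ge0// (le_trans (GM _))//.
by rewrite -mulrA ler_wpM2l.
Qed.

Theorem theorem4p2 (R : realType) (s : scalar_kind) (H : hilbertType R s)
    (Hsep : separable_space H) (J : set int) (Hj : J -> hilbertType R s)
    (W : J -> set H) (hW : forall j : J, closed_subspace (W j))
    (L : forall j : J, H -> Hj j) (hL : forall j : J, bounded_operator (L j))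
    (v : J -> R) (hv : forall j : J, 0 < v j)
    (T U : H -> H) (hT : GB T) (hU : GB U)
    (B : R) (hB : controlled_bessel W L v T B)
    (hres : resolution_of_identity (fun (j : J) (f : H) =>
       of_real s (v j ^+ 2) *:
         adjoint T (orth_proj (W j) (adjoint (L j)
           (L j (orth_proj (W j) (U f))))))) :
  controlled_frame W L v U.
Proof.
(* [B] may be nonpositive when [H] is trivial. *)
pose B1 := Num.max 1 B.
have B1_gt0 : 0 < B1 by rewrite lt_max ltr01.
have hB1 : controlled_bessel W L v T B1.
  move=> f; apply: (le_trans (hB f)).
  by rewrite lee_fin ler_wpM2r ?sqr_ge0// le_max lexx orbT.
have [b b0 hb] := controlled_sum_bound (ltW B1_gt0) hT hU.1 hB1.
(* Adding [B1^-1] to the upper bound guarantees that it dominates the lower one. *)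
exists B1^-1, (b + B1^-1); split; [by rewrite invr_gt0|by rewrite lerDr|].
move=> f; split; last first.
  apply: (le_trans (hb f)).
  by rewrite lee_fin ler_wpM2r ?sqr_ge0// lerDl invr_ge0 ltW.
pose a (C : H -> H) j := L j (orth_proj (W j) (C f)).
pose q (C : H -> H) j := v j ^+ 2 * rdot (a C j) (a C j).
have sumE C : controlled_sum W L v C f = (\esum_(j in [set: J]) (q C j)%:E)%E.
  by [].
(* The Bessel bound makes the sum finite, so the comparison takes place in [R]. *)
have [sg sgE] : exists sg : R, controlled_sum W L v U f = sg%:E.
  have := hb f; case E : (controlled_sum W L v U f) => [sg||]//.
    by exists sg.
  have : (0 <= controlled_sum W L v U f)%E; last by rewrite E.
  by apply: esum_ge0 => j _; rewrite lee_fin mulr_ge0 ?sqr_ge0 ?rdot_ge0.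
rewrite sgE lee_fin mulrC ler_pdivrMr// leNgt; apply/negP => lt_n.
set n := hnorm f in lt_n *; have n0 : 0 <= n := hnorm_ge0 f.
(* Approximating [f] within [e] will cost [2 n e], which falls short of the supposed gap
   [n^2 - sg B1] by exactly [e]. *)
pose e := (n ^+ 2 - sg * B1) / (2 * n + 1).
have n1 : 0 < 2 * n + 1 by lra.
have e0 : 0 < e by rewrite divr_gt0// subr_gt0.
have eE : e * (2 * n + 1) = n ^+ 2 - sg * B1 by rewrite mulfVK ?gt_eqF.
have nbhs_f : nbhs f [set y | hnorm (f - y) < e].
  by apply/nbhs_hnormP; exists e.
(* One finite partial sum close to [f] suffices; the series is never paired with [f] as a whole. *)
have [A _ Ae] := hres.2 f _ nbhs_f.
have {Ae} := Ae A (fsubset_refl A); rewrite /=; set S := partial_sum _ A => fS.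
have SE : rdot S f =
    partial_sum (fun j => v j ^+ 2 * rdot (a U j) (a T j)) A.
  rewrite rdot_partial_sum; apply: eq_bigr => j _.
  (* The adjoint of [T], the projection and the adjoint of [L j] are moved in turn to the other
     side. *)
  rewrite rdotZl rdotC -rdot_adjoint; last exact: hT.1.
  rewrite -orth_proj_selfadjoint//.
  by rewrite -rdot_adjoint// rdotC.
have qle C : ((partial_sum (q C) A)%:E <= controlled_sum W L v C f)%E.
  by rewrite sumE; exact: partial_sum_le_esum.
have qU : partial_sum (q U) A <= sg by rewrite -lee_fin -sgE.
have qT : partial_sum (q T) A <= B1 * n ^+ 2.
  by rewrite -lee_fin (le_trans (qle _)).
have amgm : 2 * B1 * rdot S f <=
    B1 ^+ 2 * partial_sum (q U) A + partial_sum (q T) A.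
  rewrite SE /partial_sum !mulr_sumr -big_split/= ler_sum// => j _.
  (* Expanding this square and weighting it by [v^2] gives the inequality term by term. *)
  have := rdot_ge0 (a T (val j) - of_real s B1 *: a U (val j)).
  rewrite rdot_subZ rdotC => /(mulr_ge0 (sqr_ge0 (v (val j)))).
  rewrite /q; lra.
have : n ^+ 2 <= e * n + rdot S f.
  have -> : n ^+ 2 = rdot (f - S) f + rdot S f.
    by rewrite -rdotDl subrK -hnorm_sqr.
  rewrite lerD2r (le_trans (rdot_cauchy_schwarz _ _))// ler_wpM2r//; exact: ltW.
(* Multiplying by [2 B1], inserting [amgm], [qU] and [qT], and cancelling [B1] yields
   [n^2 - sg B1 <= 2 n e], against [eE]. *)
nra.
Qed.
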